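(* Let $G$ be a Lie group with Lie algebra $\mathfrak{g}$, equipped with a left-invariant almost Hermitian structure $(\langle\cdot,\cdot\rangle,J,\omega)$. There is a one-to-one correspondence between the space of left-invariant Hermitian connections on $(G,\langle\cdot,\cdot\rangle,J,\omega)$ and the space $\wedge^{(1,1)}\mathfrak{g}^\ast\otimes\mathfrak{g}$.
   Context: $\mathfrak{g}$ is the space of left-invariant vector fields on $G$, and $\mathfrak{g}^\ast$ is its dual, the space of left-invariant 1-forms. A left-invariant almost Hermitian structure consists of a left-invariant Riemannian metric $\langle\cdot,\cdot\rangle$, a left-invariant almost complex structure $J$ orthogonal for the metric (i.e. $\langle JX,JY\rangle=\langle X,Y\rangle$), and the fundamental 2-form $\omega(X,Y)=\langle JX,Y\rangle$. A connection $\nabla$ on $G$ is Hermitian if $\nabla\langle\cdot,\cdot\rangle=0$ and $\nabla J=0$; it is left-invariant if $\nabla_XY\in\mathfrak{g}$ for all $X,Y\in\mathfrak{g}$. $\wedge^{(1,1)}\mathfrak{g}^\ast$ is the space of real left-invariant 2-forms of type (1,1) with respect to $J$, so $\wedge^{(1,1)}\mathfrak{g}^\ast\otimes\mathfrak{g}$ is the space of left-invariant $\mathfrak{g}$-valued 2-forms $\alpha$ with $\alpha(JX,JY)=\alpha(X,Y)$. *)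

(* Defs.v *)
From HB Require Import structures.
From mathcomp Require Import all_boot all_order all_algebra.
From mathcomp Require Import all_classical all_reals topology normedtype landau derive.

Set Implicit Arguments.
Unset Strict Implicit.
Unset Printing Implicit Defensive.

Import Order.TTheory GRing.Theory Num.Theory.
Import numFieldNormedType.Exports.

Local Open Scope classical_set_scope.
Local Open Scope ring_scope.

(* [f] is C^(k+1) on the open set [U] when it is differentiable on [U] and all
   its directional derivatives are C^k on [U]. Only used with [U] open and
   [V], [W] of finite dimension, where this is the usual notion. *)
Fixpoint Ck {R : realType} {V W : normedModType R} (k : nat) (U : set V)
    (f : V -> W) : Prop :=
  match k with
  | 0 => forall x, U x -> {for x, continuous f}
  | k'.+1 => (forall x, U x -> differentiable f x) /\
             forall v, Ck k' U (fun x => 'd f x v)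
  end.

Definition smooth_on {R : realType} {V W : normedModType R} (U : set V)
  (f : V -> W) : Prop := forall k, Ck k U f.

Section CkTheory.
Variables (R : realType) (V : normedModType R).
Implicit Types (U : set V).

Lemma near_eq_diff (W : normedModType R) (f g : V -> W) x :
  (\forall y \near x, f y = g y) -> differentiable f x ->
  differentiable g x /\ 'd g x = 'd f x :> (V -> W).
Proof.
move=> fg df.
have fgx : f x = g x by exact: nbhs_singleton fg.
have cdf : continuous ('d f x) by exact: diff_continuous.
have E : g \o shift x = cst (g x) + 'd f x +o_ 0 id.
  apply/eqaddoP => e e0.
  have /diff_locallyP[_ /eqaddoP /(_ _ e0) H] := df.
  have fg0 : \forall h \near (0 : V), f (h + x) = g (h + x).
    have : (fun h => h + x) @ (0 : V) --> x.
      by rewrite -[X in _ --> X]add0r; apply: cvgD; [exact: cvg_id|exact: cvg_cst].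
    by move=> /(_ _ fg).
  near=> h.
  have -> : (g \o shift x - (cst (g x) + 'd f x)) h =
            (f \o shift x - (cst (f x) + 'd f x)) h.
    have e1 : f (h + x) = g (h + x) by near: h.
    by rewrite !fctE /= fgx e1.
  by near: h.
have dg := diff_unique cdf E.
by split=> //; apply/diff_locallyP; rewrite dg; split.
Unshelve. all: by end_near. Qed.

Lemma eq_Ck (W : normedModType R) k U (f g : V -> W) : open U ->
  (forall x, U x -> f x = g x) -> Ck k U f -> Ck k U g.
Proof.
move=> oU; elim: k f g => [|k IH] f g fg /=.
  move=> cf x Ux.
  have fgx : \forall y \near x, f y = g y.
    by apply: filterS (open_nbhs_nbhs (conj oU Ux)) => y /fg.
  rewrite /prop_for /continuous_at -(fg _ Ux).
  by apply: cvg_trans (cf _ Ux); apply: near_eq_cvg.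
move=> [df Cf].
have H x : U x -> differentiable g x /\ 'd g x = 'd f x :> (V -> W).
  move=> Ux; apply: near_eq_diff; last exact: df.
  by apply: filterS (open_nbhs_nbhs (conj oU Ux)) => y /fg.
split=> [x /H[]//|v]; apply: IH (Cf v) => x /H[_ ->//].
Qed.

Lemma CkD (W : normedModType R) k U (f g : V -> W) : open U ->
  Ck k U f -> Ck k U g -> Ck k U (f \+ g).
Proof.
move=> oU; elim: k f g => [|k IH] f g /=.
  by move=> cf cg x Ux; apply: continuousD; [exact: cf|exact: cg].
move=> [df Cf] [dg Cg]; split=> [x Ux|v].
  by apply: differentiableD; [exact: df|exact: dg].
apply: eq_Ck oU _ (IH _ _ (Cf v) (Cg v)) => x Ux /=.
by have /= -> := diffD (df _ Ux) (dg _ Ux).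
Qed.

Lemma CkS (W : normedModType R) k U (f : V -> W) : Ck k.+1 U f -> Ck k U f.
Proof.
elim: k f => [|k IH] f /= [df Cf].
  by move=> x Ux; apply: differentiable_continuous; exact: df.
by split=> // v; apply: IH; exact: Cf.
Qed.

Lemma Ck_cst (W : normedModType R) k U (a : W) : Ck k U (fun=> a).
Proof.
elim: k a => [|k IH] a /=; first by move=> x _; exact: cst_continuous.
split=> [x _|v]; first exact: differentiable_cst.
rewrite (_ : (fun x => _) = fun=> 0); first exact: IH.
by apply/funext => x; have /= -> := diff_cst a x.
Qed.

Lemma scale_is_bilinear (W : normedModType R) :
  bilinear_for (GRing.Scale.Law.clone _ _ *:%R _)
    (GRing.Scale.Law.clone _ _ *:%R _) (fun (a : R^o) (w : W) => a *: w).
Proof.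
by split=> [w|a] b x y /=; [rewrite scalerDl scalerA|rewrite scalerDr !scalerA mulrC].
Qed.

Lemma diffZfun (W : normedModType R) (f : V -> R) (g : V -> W) x :
  differentiable f x -> differentiable g x ->
  differentiable (fun y => f y *: g y) x /\
  'd (fun y => f y *: g y) x = (fun v => f x *: 'd g x v + 'd f x v *: g x) :> (V -> W).
Proof.
move=> df dg.
pose bM := bilinear_isBilinear.Build R R^o W W _ _ _ (scale_is_bilinear W).
pose b : {bilinear R^o -> W -> W} := HB.pack (fun (a : R^o) (w : W) => a *: w) bM.
have cb : continuous (fun p : R^o * W => b p.1 p.2) by exact: scale_continuous.
pose F := (fun y => (f y, g y)) : V -> R^o * W.
have dF : differentiable F x by exact: differentiable_pair.
have db : differentiable (fun p : R^o * W => b p.1 p.2) (F x).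
  exact: differentiable_bilin.
split; first exact: (differentiable_comp dF db).
have /= E := diff_comp dF db.
apply/funext => v.
transitivity ('d ((fun p : R^o * W => b p.1 p.2) \o F) x v); first by [].
by rewrite E /= (diff_bilin _ cb) (@diff_pair _ V R^o W).
Qed.

Lemma CkZ (W : normedModType R) k U (f : V -> R) (g : V -> W) : open U ->
  Ck k U (f : V -> R^o) -> Ck k U g -> Ck k U (fun x => f x *: g x).
Proof.
move=> oU; elim: k f g => [|k IH] f g Cf Cg.
  move=> x Ux; apply: cvgZ; [exact: Cf|exact: Cg].
have Cf' := CkS Cf; have Cg' := CkS Cg.
case: Cf Cg => [df Cf] [dg Cg]; split=> [x Ux|v].
  by have [] := diffZfun (df _ Ux) (dg _ Ux).
apply: eq_Ck oU _ (CkD oU (IH _ _ Cf' (Cg v)) (IH _ _ (Cf v) Cg')) => x Ux /=.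
by have [_ ->] := diffZfun (df _ Ux) (dg _ Ux).
Qed.

End CkTheory.

Record chart (R : realType) (n : nat) (M : topologicalType) := Chart {
  cdom : set M;
  ccod : set 'rV[R]_n;
  cmap :> M -> 'rV[R]_n;
  cinv : 'rV[R]_n -> M;
  open_cdom : open cdom;
  open_ccod : open ccod;
  cmap_cod : forall p, cdom p -> ccod (cmap p);
  cinv_dom : forall x, ccod x -> cdom (cinv x);
  cmapK : forall p, cdom p -> cinv (cmap p) = p;
  cinvK : forall x, ccod x -> cmap (cinv x) = x;
  cmap_continuous : forall p, cdom p -> {for p, continuous cmap};
  cinv_continuous : forall x, ccod x -> {for x, continuous cinv}
}.

Record smooth_atlas (R : realType) (n : nat) (M : topologicalType) := SmoothAtlas {
  atlas : set (chart R n M);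
  atlas_cover : forall p : M, exists c, atlas c /\ cdom c p;
  atlas_compat : forall c c', atlas c -> atlas c' ->
    smooth_on (ccod c `&` cinv c @^-1` cdom c') (c' \o cinv c)
}.

HB.structure Definition GroupTopological :=
  { G of Group G & Topological G }.

HB.mixin Record isLieGroup (R : realType) (n : nat) G
    of Group G & Topological G := {
  lie_hausdorff : hausdorff_space G;
  lie_second_countable : @second_countable G;
  lie_atlas : smooth_atlas R n G;
  mulg_continuous : continuous (fun p : G * G => (p.1 * p.2)%g);
  invg_continuous : continuous (fun p : G => p^-1%g);
  mulg_smooth : forall c1 c2 c3, atlas lie_atlas c1 -> atlas lie_atlas c2 -> 
    atlas lie_atlas c3 ->
    smooth_on
      [set x : 'rV[R]_n * 'rV[R]_n | [/\ ccod c1 x.1, ccod c2 x.2 &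
                                cdom c3 (cinv c1 x.1 * cinv c2 x.2)%g]]
      (fun x => c3 (cinv c1 x.1 * cinv c2 x.2)%g);
  invg_smooth : forall c1 c2, atlas lie_atlas c1 -> atlas lie_atlas c2 ->
    smooth_on [set x | ccod c1 x /\ cdom c2 (cinv c1 x)^-1%g]
      (fun x => c2 (cinv c1 x)^-1%g)
}.

#[short(type="lieGroupType")]
HB.structure Definition LieGroup (R : realType) (n : nat) :=
  { G of isLieGroup R n G & Group G & Topological G }.

Section LieGroupTheory.
Variables (R : realType) (n : nat) (G : lieGroupType R n).
Implicit Types (p q a : G).

Definition chart_at p : chart R n G := projT1 (cid (atlas_cover (@lie_atlas R n G) p)).

(* The tangent space at [p] is ['rV[R]_n], a vector being identified with its
   components in the preferred chart [chart_at p]; [tangent_map f p] is the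
   differential of [f] at [p] under these identifications. *)
Definition tangent_map (f : G -> G) p : 'rV[R]_n -> 'rV[R]_n :=
  'd (chart_at (f p) \o f \o cinv (chart_at p)) (chart_at p p).

Definition ltrans a : G -> G := fun p => (a * p)%g.

Definition smooth_fun (f : G -> R) : Prop :=
  forall c, atlas (@lie_atlas R n G) c -> smooth_on (ccod c) (f \o cinv c : _ -> R^o).

Definition local_rep (X : G -> 'rV[R]_n) (c : chart R n G) (x : 'rV[R]_n) :
    'rV[R]_n :=
  let q := cinv c x in 'd (c \o cinv (chart_at q)) (chart_at q q) (X q).

Definition smooth_vf : {pred G -> 'rV[R]_n} := fun X =>
  `[< forall c, atlas (@lie_atlas R n G) c -> smooth_on (ccod c) (local_rep X c) >].

Lemma smooth_vf_submod : submod_closed smooth_vf.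
Proof.
split.
  apply/asboolP => c _ k.
  have -> : local_rep 0 c = fun=> 0 by apply/funext => x; exact: linear0.
  exact: Ck_cst.
move=> a X Y /asboolP sX /asboolP sY; apply/asboolP => c ac k.
have -> : local_rep (a *: X + Y) c =
    (fun x => (cst a x : R) *: local_rep X c x) \+ local_rep Y c.
  by apply/funext => x; rewrite /= /local_rep /= linearP.
apply: CkD; [exact: open_ccod|apply: CkZ|exact: sY].
- exact: open_ccod.
- exact: Ck_cst.
- exact: sX.
Qed.

HB.instance Definition _ := GRing.isSubmodClosed.Build R (G -> 'rV[R]_n)
  smooth_vf smooth_vf_submod.

Record vfield := VField { vf_fun :> G -> 'rV[R]_n; vf_smooth : vf_fun \in smooth_vf }.

HB.instance Definition _ := [isSub for vf_fun].
HB.instance Definition _ := [Choice of vfield by <:].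
HB.instance Definition _ := [SubChoice_isSubLmodule of vfield by <:].

Lemma vf_scale_subproof (f : G -> R) (X : vfield) :
  smooth_fun f -> (fun p => f p *: X p) \in smooth_vf.
Proof.
move=> sf; have /asboolP sX := vf_smooth X; apply/asboolP => c ac k.
have -> : local_rep (fun p => f p *: X p) c =
    (fun x => (f \o cinv c) x *: local_rep X c x).
  by apply/funext => x; rewrite /local_rep /= linearZ.
by apply: CkZ; [exact: open_ccod|exact: sf|exact: sX].
Qed.

Definition vf_scale (f : G -> R) (sf : smooth_fun f) (X : vfield) : vfield :=
  VField (vf_scale_subproof X sf).

Definition vf_act (X : vfield) (f : G -> R) : G -> R := fun p =>
  'd (f \o cinv (chart_at p) : _ -> R^o) (chart_at p p) (X p).

Definition left_invariant : {pred vfield} := fun X =>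
  `[< forall a p, tangent_map (ltrans a) p (X p) = X (ltrans a p) >].

Lemma left_invariant_submod : submod_closed left_invariant.
Proof.
split; first by apply/asboolP => a p; exact: linear0.
move=> k X Y /asboolP lX /asboolP lY; apply/asboolP => a p.
by rewrite /= [LHS]linearP; congr (_ *: _ + _); [exact: lX|exact: lY].
Qed.

HB.instance Definition _ := GRing.isSubmodClosed.Build R vfield
  left_invariant left_invariant_submod.

(* Only the vector space structure of the Lie algebra is needed here, so its
   bracket is not defined. *)
Record lie_algebra := LieAlgebra {
  la_vf :> vfield; la_left_invariant : la_vf \in left_invariant }.

HB.instance Definition _ := [isSub for la_vf].
HB.instance Definition _ := [Choice of lie_algebra by <:].
HB.instance Definition _ := [SubChoice_isSubLmodule of lie_algebra by <:].

Record left_invariant_almost_hermitian := AlmostHermitian {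
  ah_metric : G -> 'rV[R]_n -> 'rV[R]_n -> R;
  ah_metric_linear : forall p u, scalar (ah_metric p u);
  ah_metric_sym : forall p u v, ah_metric p u v = ah_metric p v u;
  ah_metric_pos : forall p u, u != 0 -> 0 < ah_metric p u u;
  ah_metric_smooth : forall X Y : vfield,
    smooth_fun (fun p => ah_metric p (X p) (Y p));
  ah_metric_inv : forall a p u v,
    ah_metric (ltrans a p) (tangent_map (ltrans a) p u)
      (tangent_map (ltrans a) p v) = ah_metric p u v;
  ah_J : G -> 'rV[R]_n -> 'rV[R]_n;
  ah_J_linear : forall p, linear (ah_J p);
  ah_J_sqr : forall p u, ah_J p (ah_J p u) = - u;
  ah_J_smooth : forall X : vfield, (fun p => ah_J p (X p)) \in smooth_vf;
  ah_J_inv : forall a p u,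
    ah_J (ltrans a p) (tangent_map (ltrans a) p u) =
    tangent_map (ltrans a) p (ah_J p u);
  ah_orthogonal : forall p u v, ah_metric p (ah_J p u) (ah_J p v) = ah_metric p u v
}.

Variable H : left_invariant_almost_hermitian.

Definition fundamental_form p (u v : 'rV[R]_n) : R := ah_metric H p (ah_J H p u) v.

Definition inner (X Y : vfield) : G -> R := fun p => ah_metric H p (X p) (Y p).

Definition J_vf (X : vfield) : vfield := VField (ah_J_smooth H X).

Lemma J_left_invariant (X : lie_algebra) : J_vf X \in left_invariant.
Proof.
have /asboolP lX := la_left_invariant X; apply/asboolP => a p /=.
by rewrite -ah_J_inv lX.
Qed.

Definition J_la (X : lie_algebra) : lie_algebra := LieAlgebra (J_left_invariant X).

Record connection := Connection {
  nabla :> vfield -> vfield -> vfield;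
  nabla_addl : forall X X' Y, nabla (X + X') Y = nabla X Y + nabla X' Y;
  nabla_scalel : forall f (sf : smooth_fun f) X Y,
    nabla (vf_scale sf X) Y = vf_scale sf (nabla X Y);
  nabla_addr : forall X Y Y', nabla X (Y + Y') = nabla X Y + nabla X Y';
  nabla_leibniz : forall f (sf : smooth_fun f) X Y p,
    nabla X (vf_scale sf Y) p = vf_act X f p *: Y p + f p *: nabla X Y p
}.

Definition hermitian_connection (D : connection) : Prop :=
  (forall X Y Z p,
     vf_act X (inner Y Z) p = inner (D X Y) Z p + inner Y (D X Z) p) /\
  (forall X Y, D X (J_vf Y) = J_vf (D X Y)).

Definition left_invariant_connection (D : connection) : Prop :=
  forall X Y : lie_algebra, D X Y \in left_invariant.

Record lih_connection := LIHConnection {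
  lih_conn :> connection;
  lih_hermitian : hermitian_connection lih_conn;
  lih_left_invariant : left_invariant_connection lih_conn
}.

(* A left-invariant form is determined by its values on left-invariant fields,
   so these maps are the elements of the tensor product of the left-invariant
   real (1,1)-forms with the Lie algebra. *)
Record form11 := Form11 {
  f11_fun :> lie_algebra -> lie_algebra -> lie_algebra;
  f11_linearl : forall Y, linear (f11_fun^~ Y);
  f11_linearr : forall X, linear (f11_fun X);
  f11_alt : forall X, f11_fun X X = 0;
  f11_type : forall X Y, f11_fun (J_la X) (J_la Y) = f11_fun X Y
}.

(* Connections form an affine space, in which [D] lies on the line through
   [D0] and [D1] with parameter [t] when it is their pointwise combination. *)
Definition affine_map (Phi : lih_connection -> form11) : Prop :=
  forall (t : R) (D0 D1 D : lih_connection),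
    (forall X Y, D X Y = (1 - t) *: D0 X Y + t *: D1 X Y) ->
    forall X Y, Phi D X Y = (1 - t) *: Phi D0 X Y + t *: Phi D1 X Y.

End LieGroupTheory.

(* Main.v *)
From HB Require Import structures.
Require Import Defs.
From mathcomp Require Import all_boot all_order all_algebra.
From mathcomp Require Import all_classical all_reals topology normedtype derive.

Set Implicit Arguments.
Unset Strict Implicit.
Unset Printing Implicit Defensive.

Import Order.TTheory GRing.Theory Num.Theory.
Import numFieldNormedType.Exports.

Local Open Scope classical_set_scope.
Local Open Scope ring_scope.

(** A left-invariant connection is a bilinear map [(Z, X) |-> nabla_Z X] on the
    Lie algebra [g]. Left-invariant fields have constant inner products, so a
    derivative of such a product vanishes: being metric says that every
    [nabla_Z] is skew-symmetric, and being Hermitian adds that it commutes with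
    [J]. Equivalently, [<nabla_Z X, Y>] is, for each fixed [Z], a form of type
    (1,1) in [(X, Y)]. Dualizing the remaining argument [Z] with the metric
    turns this family into one [g]-valued (1,1)-form [alpha] through
      [<alpha(X, Y), Z> = <nabla_Z X, Y>],
    and this formula is the correspondence. It is linear in the connection, so
    it is affine.

    What has to be proved is that a connection is the same thing as its
    restriction to [g], and this rests on a global frame of left-invariant
    fields. Such a frame exists because a tangent vector at the identity can be
    transported by left translations; the result is a smooth field since it is
    a partial derivative of the multiplication [G * G -> G]
    ([left_extend_smooth]). Pairing with the dual frame shows that the
    coefficients of a field in the frame are smooth ([vfield_expansion]), hence
    that a property of fields stable under sums and under multiplication by
    smooth functions holds for all fields once it holds on [g] ([vfield_ind]).

    This induction principle gives injectivity ([lih_connection_ext]).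
    Conversely, a form [alpha] yields a bilinear map [A] on [g] with
    [<A_Z X, Y> = <alpha(X, Y), Z>], and the connection is the flat one that
    kills the frame plus the tensorial extension of [A]. The induction principle
    reduces its compatibility with the metric and with [J] to the corresponding
    identities on [g], which are the alternation and the type of [alpha]. *)

(** * Calculus of C^k maps between normed spaces *)

Section Ck.
Variables (R : realType) (V : normedModType R).

(** Constancy of the derivative of [A] is what makes the induction close: the
    directional derivatives of [f \o A] are then again directional derivatives
    of [f], along fixed vectors, composed with [A]. *)
Lemma Ck_comp_affine (V' W : normedModType R) k (U : set V) (U' : set V')
    (f : V -> W) (A : V' -> V) (a : V' -> V) : open U' ->
  (forall x, U' x -> U (A x)) ->
  (forall x, differentiable A x) -> (forall x, 'd A x = a :> (V' -> V)) ->
  Ck k U f -> Ck k U' (f \o A).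
Proof.
move=> oU' UA dA dAa; elim: k f => [|k IH] f /=.
  move=> cf x Ux; apply: continuous_comp; last exact/cf/UA.
  exact: differentiable_continuous.
move=> [df Cf]; split=> [x Ux|v].
  by apply: differentiable_comp; [exact: dA|exact (df _ (UA _ Ux))].
apply: eq_Ck oU' _ (IH _ (Cf (a v))) => x Ux /=.
by have /= -> := diff_comp (dA x) (df _ (UA _ Ux)); rewrite dAa.
Qed.

Lemma Ck_lin (W W' : normedModType R) k (U : set V) (f : V -> W)
    (L : {linear W -> W'}) : open U -> continuous L ->
  Ck k U f -> Ck k U (L \o f).
Proof.
move=> oU cL; elim: k f => [|k IH] f /=.
  by move=> cf x Ux; apply: continuous_comp; [exact: cf|exact: cL].
move=> [df Cf]; split=> [x Ux|v].
  by apply: differentiable_comp; [exact: df|exact: linear_differentiable].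
apply: eq_Ck oU _ (IH _ (Cf v)) => x Ux /=.
have /= -> := diff_comp (df _ Ux) (linear_differentiable (f x) cL).
by rewrite diff_lin.
Qed.

Lemma Ck_sum (W : normedModType R) k (U : set V) m (f : 'I_m -> V -> W) :
  open U -> (forall i, Ck k U (f i)) -> Ck k U (fun x => \sum_(i < m) f i x).
Proof.
move=> oU Cf; elim: m f Cf => [|m IH] f Cf.
  by apply: eq_Ck oU _ (Ck_cst k U 0) => x Ux; rewrite big_ord0.
have Cf' := IH _ (fun i => Cf (widen_ord (leqnSn m) i)).
by apply: eq_Ck oU _ (CkD oU Cf' (Cf ord_max)) => x Ux; rewrite big_ord_recr.
Qed.

Lemma is_diff_pairl (W : normedModType R) (e : W) (x : V) :
  is_diff x (fun y => (y, e)) (fun v => (v, 0)).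
Proof. exact: (is_diff_pair (is_diff_id x) (is_diff_cst e x)). Qed.

Lemma is_diff_pairr (W : normedModType R) (e : W) (x : V) :
  is_diff x (fun y => (e, y)) (fun v => (0, v)).
Proof. exact: (is_diff_pair (is_diff_cst e x) (is_diff_id x)). Qed.

End Ck.

(** Being C^k only controls derivatives along fixed vectors, so the varying
    direction [w x] is decomposed on the canonical basis. *)
Lemma Ck_diff_along (R : realType) m (W : normedModType R) (U : set 'rV[R]_m)
  (g : 'rV[R]_m -> W) (w : 'rV[R]_m -> 'rV[R]_m) : open U ->
  smooth_on U g -> smooth_on U w -> smooth_on U (fun x => 'd g x (w x)).
Proof.
move=> oU sg sw k.
pose co (j : 'I_m) (v : 'rV[R]_m) : R^o := v ord0 j.
have lco j : linear (co j) by move=> a x y; rewrite /co !mxE.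
pose Lco j : {linear 'rV[R]_m -> R^o} :=
  HB.pack (co j) (GRing.isLinear.Build _ _ _ _ _ (lco j)).
have C j : Ck k U (fun x => (w x ord0 j) *: 'd g x (delta_mx 0 j)).
  apply: CkZ => //; last by have [_] := sg k.+1; apply.
  apply: (@Ck_lin _ _ _ _ k U w (Lco j)) => // x.
  exact: coord_continuous.
apply: eq_Ck oU _ (Ck_sum oU C) => x Ux.
rewrite {2}[w x]row_sum_delta linear_sum.
by apply: eq_bigr => j _; rewrite linearZ.
Qed.

(** * Left-invariant extension of tangent vectors *)

Section Charts.
Variables (R : realType) (n : nat) (G : lieGroupType R n).
Implicit Types (p q a : G).
Local Notation A := (atlas (@lie_atlas R n G)).

Lemma atlas_chart_at p : A (chart_at p).
Proof. by rewrite /chart_at; case: cid => c []. Qed.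

Lemma cdom_chart_at p : cdom (chart_at p) p.
Proof. by rewrite /chart_at; case: cid => c []. Qed.

(** The chain rule for a composite passing through the group. Every change of
    chart below is an instance of it, since tangent vectors at [q] are read in
    the chart [chart_at q], which varies with [q]. *)
Lemma diff_through_chart (V W : normedModType R) (g : V -> G) (h : G -> W)
    (c : chart R n G) x q :
  g x = q -> cdom c q -> {for x, continuous g} ->
  differentiable (c \o g) x -> differentiable (h \o cinv c) (c q) ->
  differentiable (h \o g) x /\
  forall v, 'd (h \o g) x v = 'd (h \o cinv c) (c q) ('d (c \o g) x v).
Proof.
move=> <- cgx cg dg dh.
have E : \forall y \near x, ((h \o cinv c) \o (c \o g)) y = (h \o g) y.
  have cgx' : \forall y \near x, cdom c (g y).
    by apply: cg; apply: open_nbhs_nbhs; split => //; exact: open_cdom.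
  by apply: filterS cgx' => y /= cy; rewrite cmapK.
have d : differentiable ((h \o cinv c) \o (c \o g)) x.
  exact: differentiable_comp.
have [d' E'] := near_eq_diff E d.
by split=> // v; rewrite E' diff_comp.
Qed.

Lemma continuous_ltrans a : continuous (ltrans a).
Proof.
move=> p.
have := @mulg_continuous _ _ G (a, p).
move=> /(continuous_comp (f := fun q : G => (a, q))); apply.
by apply: cvg_pair; [exact: cvg_cst|exact: cvg_id].
Qed.

Lemma transition_diff (c c' : chart R n G) p :
  A c -> A c' -> cdom c p -> cdom c' p ->
  differentiable (c' \o cinv c) (c p).
Proof.
move=> ac ac' cp c'p.
have [d _] := atlas_compat ac ac' 1%N; apply: d; split; first exact: cmap_cod.
by rewrite /= cmapK.
Qed.

(** In charts, a left translation is the multiplication precomposed with the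
    affine map [y |-> (ca a, y)]. *)
Lemma ltrans_diff (c c' : chart R n G) a p :
  A c -> A c' -> cdom c p -> cdom c' (a * p)%g ->
  differentiable (c' \o (ltrans a \o cinv c)) (c p).
Proof.
move=> ac ac' cp c'p.
pose ca := chart_at a.
have aca := atlas_chart_at a; have caa := cdom_chart_at a.
have [d _] := mulg_smooth _ _ _ aca ac ac' 1%N.
have {}d := d (ca a, c p).
have -> : c' \o (ltrans a \o cinv c) =
  (fun x => c' (cinv ca x.1 * cinv c x.2)%g) \o (fun y => (ca a, y)).
  by apply/funext => y /=; rewrite cmapK.
apply: differentiable_comp; first by apply: differentiable_pair.
by apply: d; split; rewrite /= ?cmapK//; exact: cmap_cod.
Qed.

Lemma cinv_continuous_at (c : chart R n G) p :
  cdom c p -> {for (c p), continuous (cinv c)}.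
Proof. by move=> cp; apply/cinv_continuous/cmap_cod. Qed.

Lemma ltrans_cinv_continuous (c : chart R n G) a p :
  cdom c p -> {for (c p), continuous (ltrans a \o cinv c)}.
Proof.
move=> cp; apply: continuous_comp; first exact: cinv_continuous_at.
exact: continuous_ltrans.
Qed.

(** The value at [p] of the left-invariant field equal to [v] at the identity.
    It is [tangent_map (ltrans p) 1 v] with the chart [chart_at (p * 1)] written
    as [chart_at p]. *)
Definition left_extend (v : 'rV[R]_n) (p : G) : 'rV[R]_n :=
  'd (chart_at p \o (ltrans p \o cinv (chart_at (1%g : G))))
    (chart_at (1%g : G) 1%g) v.

(** Reading the field in a fixed chart [c] eliminates [chart_at p], which depends
    on [p] in an uncontrolled way; only then can smoothness in [p] be
    discussed. *)
Lemma diff_left_extend (c : chart R n G) (p : G) (v : 'rV[R]_n) :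
  A c -> cdom c p ->
  'd (c \o cinv (chart_at p)) (chart_at p p) (left_extend v p) =
  'd (c \o (ltrans p \o cinv (chart_at (1%g : G)))) (chart_at (1%g : G) 1%g) v.
Proof.
move=> ac cp; set c1 := chart_at (1%g : G).
have d1 : cdom c1 1%g by exact: cdom_chart_at.
have E : (ltrans p \o cinv c1) (c1 1%g) = p by rewrite /= cmapK// /ltrans mulg1.
have [] := diff_through_chart (h := c) E (cdom_chart_at p).
- exact: ltrans_cinv_continuous.
- by apply: ltrans_diff; rewrite ?mulg1//;
    do ?[exact: atlas_chart_at|exact: cdom_chart_at].
- by apply: transition_diff => //; [exact: atlas_chart_at|exact: cdom_chart_at].
by move=> _ /(_ v)/esym.
Qed.

(** In a chart, the field is the partial derivative along [(0, v)] of the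
    multiplication [F], taken along the slice of points [(x, c1 1)]. Hence it is
    C^k because [F] is C^k.+1. *)
Lemma left_extend_smooth v : left_extend v \in @smooth_vf R n G.
Proof.
apply/asboolP => c ac k; set c1 := chart_at (1%g : G).
have ac1 : A c1 by exact: atlas_chart_at.
have d1 : cdom c1 1%g by exact: cdom_chart_at.
have [dF CF] := mulg_smooth _ _ _ ac ac1 ac k.+1.
set F := (fun x : 'rV[R]_n * 'rV[R]_n =>
  c (cinv c x.1 * cinv c1 x.2)%g) in dF CF.
pose B (x : 'rV[R]_n) := (x, c1 1%g).
have isB x : is_diff x B (fun v => (v, 0)) by exact: is_diff_pairl.
have dB x : differentiable B x by exact: ex_diff.
have dBE x : 'd B x = (fun v => (v, 0)) :> (_ -> _) by exact: diff_val.
have UB x : ccod c x -> [/\ ccod c (B x).1, ccod c1 (B x).2 &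
   cdom c (cinv c (B x).1 * cinv c1 (B x).2)%g].
  move=> cx; split => //=; first exact: cmap_cod.
  by rewrite cmapK// mulg1; exact: cinv_dom.
have := Ck_comp_affine (@open_ccod _ _ _ c) UB dB dBE (CF (0, v)).
apply: eq_Ck; first exact: open_ccod.
move=> x cx /=.
rewrite /local_rep /= diff_left_extend//; last exact: cinv_dom.
pose B' (y : 'rV[R]_n) := (x, y).
have isB' y : is_diff y B' (fun v => (0, v)) by exact: is_diff_pairr.
have -> : c \o (ltrans (cinv c x) \o cinv c1) = F \o B' by [].
have dB' := @ex_diff _ _ _ _ _ _ _ (isB' (c1 1%g)).
have /= -> := diff_comp dB' (dF _ (UB _ cx)).
by rewrite diff_val.
Qed.

Definition left_extend_vf v := VField (left_extend_smooth v).

(** The chain rule for [ltrans (a * p) = ltrans a \o ltrans p]. *)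
Lemma left_extend_vf_left_invariant v :
  left_extend_vf v \in @left_invariant R n G.
Proof.
apply/asboolP => a p /=; rewrite /left_extend /tangent_map.
set c1 := chart_at (1%g : G).
have d1 : cdom c1 1%g by exact: cdom_chart_at.
have E : (ltrans p \o cinv c1) (c1 1%g) = p by rewrite /= cmapK// /ltrans mulg1.
have [] := diff_through_chart (h := chart_at (ltrans a p) \o ltrans a) E
  (cdom_chart_at p).
- exact: ltrans_cinv_continuous.
- by apply: ltrans_diff; rewrite ?mulg1//;
    do ?[exact: atlas_chart_at|exact: cdom_chart_at].
- by apply: ltrans_diff => //; do ?[exact: atlas_chart_at|exact: cdom_chart_at].
have -> : (chart_at (ltrans a p) \o ltrans a) \o (ltrans p \o cinv c1) =
    chart_at (ltrans a p) \o (ltrans (ltrans a p) \o cinv c1).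
  by apply/funext => y /=; rewrite /ltrans mulgA.
by move=> _ /(_ v)/esym.
Qed.

Definition left_extend_la v := LieAlgebra (left_extend_vf_left_invariant v).

Lemma left_extend_la1 v : left_extend_la v 1%g = v.
Proof.
rewrite /= /left_extend; set c1 := chart_at (1%g : G).
have d1 : cdom c1 1%g by exact: cdom_chart_at.
have E : \forall y \near c1 1%g, id y = (c1 \o (ltrans 1%g \o cinv c1)) y.
  have : nbhs (c1 1%g) (ccod c1).
    by apply: open_nbhs_nbhs; split; [exact: open_ccod|exact: cmap_cod].
  by apply: filterS => y cy; rewrite /= /ltrans mul1g cinvK.
have did := is_diff_id (c1 1%g).
have [_ ->] := near_eq_diff E (@ex_diff _ _ _ _ _ _ _ did).
by rewrite (@diff_val _ _ _ _ _ _ _ did).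
Qed.

Lemma left_invariantE (X : vfield G) : X \in @left_invariant R n G ->
  forall p, X p = left_extend (X 1%g) p.
Proof.
move=> /asboolP/(_ _ 1%g) lX p; have := lX p.
by rewrite /tangent_map /ltrans mulg1 => <-.
Qed.

Lemma lie_algebra_inj (X Y : lie_algebra G) : X 1%g = Y 1%g -> X = Y.
Proof.
move=> XY; apply/val_inj/val_inj/funext => p /=.
rewrite (left_invariantE (la_left_invariant X)).
by rewrite (left_invariantE (la_left_invariant Y)) XY.
Qed.

(** * Derivations along vector fields *)

Lemma smooth_fun_diff f (c : chart R n G) p : smooth_fun f -> A c -> cdom c p ->
  differentiable (f \o cinv c : _ -> R^o) (c p).
Proof. by move=> sf ac cp; have [d _] := sf _ ac 1%N; exact/d/cmap_cod. Qed.

(** In a chart [c], the derivative is that of [f \o cinv c] along the components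
    of [X] in the same chart [c], both smooth. *)
Lemma vf_act_smooth (X : vfield G) f : smooth_fun f -> smooth_fun (vf_act X f).
Proof.
move=> sf c ac.
have /asboolP/(_ _ ac) sX := vf_smooth X.
move=> k; have := Ck_diff_along (@open_ccod _ _ _ c) (sf _ ac) sX k.
apply: eq_Ck; first exact: open_ccod.
move=> x cx; rewrite /local_rep /= /vf_act.
have cq := cinv_dom cx; have := cdom_chart_at (cinv c x).
have := atlas_chart_at (cinv c x); have := cinvK cx.
move: (cinv c x) cq => q; set c' := chart_at q => cq qx ac' c'q.
have E : cinv c' (c' q) = q by rewrite cmapK.
have [] := diff_through_chart (W := R^o) (h := f) E cq.
- exact: cinv_continuous_at.
- exact: transition_diff.
- by apply: smooth_fun_diff.
by rewrite qx => _ /(_ (X q)) /esym.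
Qed.

End Charts.

Section Derivation.
Variables (R : realType) (n : nat) (G : lieGroupType R n).
Implicit Types (X Y : vfield G) (f g : G -> R).

Lemma vf_actDl X Y f p : vf_act (X + Y) f p = vf_act X f p + vf_act Y f p.
Proof. exact: linearD. Qed.

Lemma vf_actZl f (sf : smooth_fun f) X g p :
  vf_act (vf_scale sf X) g p = f p * vf_act X g p.
Proof. exact: linearZ. Qed.

Lemma vf_act_cst X a p : vf_act X (cst a) p = 0.
Proof.
rewrite /vf_act.
by have /= -> := @diff_cst _ _ R^o a (chart_at p p).
Qed.

Lemma smooth_fun_at f p : smooth_fun f ->
  differentiable (f \o cinv (chart_at p) : _ -> R^o) (chart_at p p).
Proof.
move=> sf; apply: smooth_fun_diff => //; first exact: atlas_chart_at.
exact: cdom_chart_at.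
Qed.

Lemma vf_actD X f g p : smooth_fun f -> smooth_fun g ->
  vf_act X (fun q => f q + g q) p = vf_act X f p + vf_act X g p.
Proof.
move=> sf sg; rewrite /vf_act.
by have /= -> := diffD (smooth_fun_at p sf) (smooth_fun_at p sg).
Qed.

Lemma vf_actM X f g p : smooth_fun f -> smooth_fun g ->
  vf_act X (fun q => f q * g q) p = f p * vf_act X g p + vf_act X f p * g p.
Proof.
move=> sf sg; rewrite /vf_act.
have [_ /(congr1 (@^~ (X p))) /= e] :=
  diffZfun (smooth_fun_at p sf) (smooth_fun_at p sg).
rewrite cmapK in e; last exact: cdom_chart_at.
exact: e.
Qed.

Lemma smooth_cst (a : R) : smooth_fun (cst a : G -> R).
Proof. by move=> c _ k; exact: Ck_cst. Qed.

Lemma vf_scale_cst a X : vf_scale (smooth_cst a) X = a *: X.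
Proof. exact: val_inj. Qed.

Lemma vf_sumE m (F : 'I_m -> vfield G) p :
  (\sum_(i < m) F i) p = \sum_(i < m) F i p.
Proof. by apply: (big_morph (fun X : vfield G => X p)). Qed.

End Derivation.

(** * Left-invariant frames *)

Section Metric.
Variables (R : realType) (n : nat) (G : lieGroupType R n).
Variable H : left_invariant_almost_hermitian G.
Local Notation g := (lie_algebra G).
Local Notation metric := (ah_metric H).
Local Notation inner := (inner H).
Implicit Types (p q : G) (u v w : 'rV[R]_n) (X Y Z : vfield G).

Lemma metricDr p u v w : metric p u (v + w) = metric p u v + metric p u w.
Proof. by have := ah_metric_linear H p u 1 v w; rewrite scale1r mul1r. Qed.

Lemma metricZr p u a v : metric p u (a *: v) = a * metric p u v.
Proof.
have m0 : metric p u 0 = 0.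
  have := metricDr p u 0 0; rewrite addr0 => /esym/eqP.
  by rewrite -subr_eq0 addrK => /eqP.
by have := ah_metric_linear H p u a v 0; rewrite addr0 m0 addr0.
Qed.

Lemma metricDl p u v w : metric p (u + v) w = metric p u w + metric p v w.
Proof. by rewrite !(ah_metric_sym _ _ _ w) metricDr. Qed.

Lemma metricZl p a u v : metric p (a *: u) v = a * metric p u v.
Proof. by rewrite !(ah_metric_sym _ _ _ v) metricZr. Qed.

Lemma metric_sumr p u m (F : 'I_m -> 'rV[R]_n) :
  metric p u (\sum_i F i) = \sum_i metric p u (F i).
Proof.
apply: (big_morph (metric p u)); first exact: metricDr.
by rewrite -[X in metric p u X](scale0r 0) metricZr mul0r.
Qed.

Definition gram p : 'M[R]_n :=
  \matrix_(i, j) metric p (delta_mx 0 i) (delta_mx 0 j).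

Lemma metricE p u v : metric p u v = (u *m gram p *m v^T) ord0 ord0.
Proof.
rewrite {1}[v]row_sum_delta metric_sumr !mxE; apply: eq_bigr => j _.
rewrite metricZr !mxE mulrC; congr (_ * _).
rewrite ah_metric_sym {1}[u]row_sum_delta metric_sumr; apply: eq_bigr => i _.
by rewrite metricZr ah_metric_sym !mxE.
Qed.

Lemma metric_nondeg p u : (forall v, metric p u v = 0) -> u = 0.
Proof.
by move=> u0; apply/eqP/negP => /negP /(ah_metric_pos H p); rewrite u0 ltxx.
Qed.

Lemma gram_unit p : gram p \in unitmx.
Proof.
rewrite -row_free_unit -kermx_eq0; apply/rowV0P => u /sub_kermxP uM.
by apply: (@metric_nondeg p) => v; rewrite metricE uM mul0mx mxE.
Qed.

Definition frame (i : 'I_n) : g := left_extend_la G (delta_mx 0 i).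

(** The dual frame, as vector fields: metrically dual vectors at the identity,
    extended. Working with a dual pair of frames avoids orthonormalization. *)
Definition coframe (i : 'I_n) : g :=
  left_extend_la G (row i (invmx (gram 1%g))).

Lemma inner_la_cst (X Y : g) p : inner X Y p = inner X Y 1%g.
Proof.
have /asboolP/(_ p 1%g) lX := la_left_invariant X.
have /asboolP/(_ p 1%g) lY := la_left_invariant Y.
have := ah_metric_inv H p 1%g (X 1%g) (Y 1%g); rewrite lX lY.
by rewrite /inner /ltrans mulg1.
Qed.

(** Both frames are left-invariant, so it suffices to check the duality at the
    identity, where it is the definition of the inverse of [gram 1]. *)
Lemma metric_frame_coframe i j p :
  metric p (frame i p) (coframe j p) = (i == j)%:R.
Proof.
rewrite -[LHS]/(inner (frame i) (coframe j) p) inner_la_cst /inner.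
rewrite !left_extend_la1.
have gram_tr : gram 1%g = (gram 1%g)^T.
  by apply/matrixP => k l; rewrite !mxE ah_metric_sym.
rewrite metricE rowE trmx_mul trmx_inv -gram_tr mulmxA -(mulmxA _ (gram _)).
rewrite mulmxV ?gram_unit// mulmx1 trmx_delta mul_delta_mx_cond.
by case: (i == j); rewrite mxE ?eqxx.
Qed.

(** Duality reads [E *m (gram p *m C^T) = 1] for the matrices [E] and [C] of the
    two frames; for square matrices the product in the other order is also the
    identity, and that is the expansion. *)
Lemma frame_expansion p v :
  v = \sum_i metric p v (coframe i p) *: frame i p.
Proof.
pose E : 'M[R]_n := \matrix_i frame i p.
pose C : 'M[R]_n := \matrix_i coframe i p.
have EC : E *m (gram p *m C^T) = 1%:M.
  apply/matrixP => i j; rewrite -[RHS]/(1%:M i j) [RHS]mxE.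
  rewrite -(metric_frame_coframe i j p) metricE.
  rewrite mulmxA !mxE; apply: eq_bigr => k _; rewrite !mxE; congr (_ * _).
  by apply: eq_bigr => l _; rewrite !mxE.
rewrite -[LHS]mulmx1 -(mulmx1C EC) !mulmxA [LHS]mulmx_sum_row.
apply: eq_bigr => i _; rewrite rowK metricE; congr (_ *: _).
by rewrite !mxE; apply: eq_bigr => k _; rewrite !mxE.
Qed.

Lemma inner_smooth X Y : smooth_fun (inner X Y).
Proof. exact: ah_metric_smooth. Qed.

(** The coefficients are inner products of smooth fields, so their smoothness is
    part of the smoothness of the metric. *)
Lemma vfield_expansion X :
  X = \sum_i vf_scale (inner_smooth X (coframe i)) (frame i).
Proof.
apply/val_inj/funext => p /=.
by rewrite vf_sumE {1}[X p](frame_expansion p).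
Qed.

(** How identities between expressions that are tensorial in a field are reduced
    to left-invariant fields. *)
Lemma vfield_ind (P : vfield G -> Prop) :
  (forall X Y, P X -> P Y -> P (X + Y)) ->
  (forall f (sf : smooth_fun f) X, P X -> P (vf_scale sf X)) ->
  (forall X : g, P X) -> forall X, P X.
Proof.
move=> PD PZ Pg X; rewrite [X]vfield_expansion.
by apply: big_ind => [|//|i _]; [exact: (Pg 0)|exact/PZ/Pg].
Qed.

Lemma lie_algebra_expansion (X : g) :
  X = \sum_i inner X (coframe i) 1%g *: frame i.
Proof.
apply/val_inj; rewrite {1}[val X]vfield_expansion raddf_sum.
apply: eq_bigr => i _.
by apply/val_inj/funext => p; rewrite -(inner_la_cst X (coframe i) p).
Qed.

Lemma linear_expansion (V : lmodType R) (f : g -> V) (X : g) : linear f ->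
  f X = \sum_i inner X (coframe i) 1%g *: f (frame i).
Proof.
move=> lf.
pose F : {linear g -> V} := HB.pack f (GRing.isLinear.Build _ _ _ _ _ lf).
rewrite {1}[X]lie_algebra_expansion -[f]/(F : _ -> _) linear_sum.
by apply: eq_bigr => i _; rewrite linearZ.
Qed.

Definition la_inner (X Y : g) : R := inner X Y 1%g.

Lemma la_innerC (X Y : g) : la_inner X Y = la_inner Y X.
Proof. exact: ah_metric_sym. Qed.

Lemma la_innerDl (X Y Z : g) : la_inner (X + Y) Z = la_inner X Z + la_inner Y Z.
Proof. exact: metricDl. Qed.

Lemma la_innerZl a (X Z : g) : la_inner (a *: X) Z = a * la_inner X Z.
Proof. exact: metricZl. Qed.

Lemma la_inner_linearl a (X Y Z : g) :
  la_inner (a *: X + Y) Z = a * la_inner X Z + la_inner Y Z.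
Proof. by rewrite la_innerDl la_innerZl. Qed.

Lemma la_inner_linearr a (X Y Z : g) :
  la_inner X (a *: Y + Z) = a * la_inner X Y + la_inner X Z.
Proof. by rewrite !(la_innerC X) la_inner_linearl. Qed.

Lemma la_inner_nondeg (X Y : g) :
  (forall Z : g, la_inner X Z = la_inner Y Z) -> X = Y.
Proof.
move=> XY; apply/lie_algebra_inj/eqP; rewrite -subr_eq0; apply/eqP.
apply: (@metric_nondeg 1%g) => v; rewrite -scaleN1r metricDl metricZl mulN1r.
have := XY (left_extend_la G v); rewrite /la_inner /inner !left_extend_la1 => ->.
by rewrite subrr.
Qed.

Definition riesz (phi : g -> R) : g := \sum_i phi (frame i) *: coframe i.

Lemma la_inner_riesz (phi : g -> R^o) (Z : g) :
  linear phi -> la_inner (riesz phi) Z = phi Z.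
Proof.
move=> lphi; rewrite [RHS](linear_expansion _ lphi).
have ipl : linear (fun X : g => la_inner X Z : R^o).
  by move=> a X Y; rewrite la_inner_linearl.
pose F : {linear g -> R^o} :=
  HB.pack (fun X : g => la_inner X Z : R^o) (GRing.isLinear.Build _ _ _ _ _ ipl).
rewrite -[LHS]/(F _) linear_sum; apply: eq_bigr => i _; rewrite linearZ.
by rewrite -[LHS]/(phi (frame i) * la_inner (coframe i) Z) mulrC la_innerC.
Qed.

End Metric.

(** * From connections to (1,1)-forms *)

Section Correspondence.
Variables (R : realType) (n : nat) (G : lieGroupType R n).
Variable H : left_invariant_almost_hermitian G.
Local Notation g := (lie_algebra G).
Local Notation inner := (inner H).
Local Notation la_inner := (la_inner H).
Local Notation coframe := (coframe H).
Local Notation frame := (@frame R n G).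

Lemma innerDl (X Y Z : vfield G) p :
  inner (X + Y) Z p = inner X Z p + inner Y Z p.
Proof. exact: metricDl. Qed.

Lemma innerZl f (sf : smooth_fun f) (X Z : vfield G) p :
  inner (vf_scale sf X) Z p = f p * inner X Z p.
Proof. exact: metricZl. Qed.

Lemma innerDr (X Y Z : vfield G) p :
  inner X (Y + Z) p = inner X Y p + inner X Z p.
Proof. exact: metricDr. Qed.

Lemma innerZr f (sf : smooth_fun f) (X Z : vfield G) p :
  inner X (vf_scale sf Z) p = f p * inner X Z p.
Proof. exact: metricZr. Qed.

Lemma J_vfD (X Y : vfield G) : J_vf H (X + Y) = J_vf H X + J_vf H Y.
Proof.
apply/val_inj/funext => p; have := ah_J_linear H p 1 (X p) (Y p).
by rewrite !scale1r.
Qed.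

Lemma J_vfZ f (sf : smooth_fun f) (X : vfield G) :
  J_vf H (vf_scale sf X) = vf_scale sf (J_vf H X).
Proof.
apply/val_inj/funext => p; have := ah_J_linear H p (f p) (X p) 0.
have J0 : ah_J H p 0 = 0.
  have := ah_J_linear H p 1 0 0; rewrite !scale1r !addr0.
  by move=> /esym/eqP; rewrite -subr_eq0 addrK => /eqP.
by rewrite J0 !addr0.
Qed.

Lemma J_laK (X : g) : J_la H (J_la H X) = - X.
Proof. by apply/val_inj/val_inj/funext => p; exact: ah_J_sqr. Qed.

Lemma la_innerJ (X Y : g) : la_inner (J_la H X) (J_la H Y) = la_inner X Y.
Proof. exact: ah_orthogonal. Qed.

Lemma la_inner0l (X : g) : la_inner 0 X = 0.
Proof. by rewrite -(scale0r 0) la_innerZl mul0r. Qed.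

Lemma la_innerNl (X Y : g) : la_inner (- X) Y = - la_inner X Y.
Proof. by rewrite -scaleN1r la_innerZl mulN1r. Qed.

Lemma la_innerJl (X Y : g) : la_inner (J_la H X) Y = - la_inner X (J_la H Y).
Proof. by rewrite -la_innerJ J_laK la_innerNl. Qed.

Lemma la_sumE m (F : 'I_m -> g) p : (\sum_(i < m) F i) p = \sum_(i < m) F i p.
Proof. by apply: (big_morph (fun X : g => X p)). Qed.

Section ConnectionToForm.
Variable D : lih_connection H.

Definition la_nabla (X Y : g) : g := LieAlgebra (lih_left_invariant D X Y).

Lemma la_nabla_linearl Y : linear (la_nabla^~ Y).
Proof.
move=> a X X'; apply/val_inj => /=.
by rewrite nabla_addl -(vf_scale_cst a X) nabla_scalel vf_scale_cst.
Qed.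

Lemma la_nabla_linearr X : linear (la_nabla X).
Proof.
move=> a Y Y'; apply/val_inj => /=.
rewrite nabla_addr; congr (_ + _); apply/val_inj/funext => p.
rewrite -[LHS]/(lih_conn D X (a *: (Y : vfield G)) p) -(vf_scale_cst a Y).
by rewrite nabla_leibniz vf_act_cst scale0r add0r.
Qed.

(** [<Y, Z>] is constant, so its derivative in the metric compatibility
    vanishes. *)
Lemma la_nabla_skew X Y Z :
  la_inner (la_nabla X Y) Z = - la_inner Y (la_nabla X Z).
Proof.
apply/eqP; rewrite -addr_eq0; apply/eqP.
have [/(_ X Y Z 1%g) <- _] := lih_hermitian D.
have -> : inner Y Z = cst (la_inner Y Z).
  by apply/funext => p; exact: inner_la_cst.
exact: vf_act_cst.
Qed.

Lemma la_nabla_J X Y : la_nabla X (J_la H Y) = J_la H (la_nabla X Y).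
Proof. by apply/val_inj; have [_] := lih_hermitian D; apply. Qed.

Definition form_fun (X Y : g) : g :=
  riesz H (fun Z => la_inner (la_nabla Z X) Y).

Lemma form_funE X Y Z : la_inner (form_fun X Y) Z = la_inner (la_nabla Z X) Y.
Proof.
rewrite /form_fun la_inner_riesz// => a Z1 Z2.
by rewrite la_nabla_linearl la_inner_linearl.
Qed.

Lemma form_linearr X : linear (form_fun X).
Proof.
move=> a Y Y'; apply: (@la_inner_nondeg _ _ _ H) => Z.
by rewrite la_inner_linearl !form_funE la_inner_linearr.
Qed.

Lemma form_linearl Y : linear (form_fun^~ Y).
Proof.
move=> a X X'; apply: (@la_inner_nondeg _ _ _ H) => Z.
by rewrite la_inner_linearl !form_funE la_nabla_linearr la_inner_linearl.
Qed.

Lemma form_alt X : form_fun X X = 0.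
Proof.
apply: (@la_inner_nondeg _ _ _ H) => Z; rewrite la_inner0l form_funE.
have := la_nabla_skew Z X X; rewrite (la_innerC _ X) => /eqP.
by rewrite -addr_eq0 -mulr2n mulrn_eq0 => /eqP.
Qed.

Lemma form_type X Y : form_fun (J_la H X) (J_la H Y) = form_fun X Y.
Proof.
by apply: (@la_inner_nondeg _ _ _ H) => Z; rewrite !form_funE la_nabla_J la_innerJ.
Qed.

Definition form_of_connection : form11 H :=
  Form11 form_linearl form_linearr form_alt form_type.

End ConnectionToForm.

(** The difference of two connections is tensorial in both arguments: the
    derivative terms of the Leibniz rule cancel. *)
Lemma lih_connection_ext (D D' : lih_connection H) :
  (forall X Y : g, D X Y = D' X Y) -> D = D'.
Proof.
move=> DD'.
have DE X : forall Y, D X Y = D' X Y.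
  elim/(@vfield_ind _ _ _ H): X => [X X' IX IX' Y|f sf X IX Y|X].
  - by rewrite !nabla_addl IX IX'.
  - by rewrite !nabla_scalel IX.
  elim/(@vfield_ind _ _ _ H) => [Y Y' IY IY'|f sf Y IY|Y]; last exact: DD'.
  - by rewrite !nabla_addr IY IY'.
  - by apply/val_inj/funext => p; rewrite /= !nabla_leibniz IY.
have {}DE : D = D' :> (_ -> _ -> _) by apply/funext => X; apply/funext.
case: D D' DE {DD'} => [[N a1 a2 a3 a4] h l] [[N' b1 b2 b3 b4] h' l'] /= E.
subst N'.
have e1 := Prop_irrelevance a1 b1; have e2 := Prop_irrelevance a2 b2.
have e3 := Prop_irrelevance a3 b3; have e4 := Prop_irrelevance a4 b4.
subst b1 b2 b3 b4.
by rewrite (Prop_irrelevance h h') (Prop_irrelevance l l').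
Qed.

Lemma form_of_connection_inj : injective form_of_connection.
Proof.
move=> D D' DD'; apply: lih_connection_ext => X Y.
have /(congr1 val) // : la_nabla D X Y = la_nabla D' X Y.
apply: (@la_inner_nondeg _ _ _ H) => Z; rewrite -!form_funE.
by rewrite -[form_fun D]/(f11_fun (form_of_connection D)) DD'.
Qed.

(** * From (1,1)-forms to connections *)

Section FormToConnection.
Variable alpha : form11 H.

(** The endomorphism [A_X] of [g] applied to [Y], that is, the value of
    [nabla_X Y] for the connection to be built. *)
Definition potential (X Y : g) : g :=
  riesz H (fun Z => la_inner (alpha Y Z) X).

Lemma potentialE X Y Z : la_inner (potential X Y) Z = la_inner (alpha Y Z) X.
Proof.
rewrite /potential la_inner_riesz// => a Z1 Z2.
by rewrite f11_linearr la_inner_linearl.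
Qed.

Lemma potential_linearl Y : linear (potential^~ Y).
Proof.
move=> a X X'; apply: (@la_inner_nondeg _ _ _ H) => Z.
by rewrite la_inner_linearl !potentialE la_inner_linearr.
Qed.

Lemma potential_linearr X : linear (potential X).
Proof.
move=> a Y Y'; apply: (@la_inner_nondeg _ _ _ H) => Z.
by rewrite la_inner_linearl !potentialE f11_linearl la_inner_linearl.
Qed.

Lemma f11_skew X Y : alpha X Y = - alpha Y X.
Proof.
have addl (U V W : g) : alpha (U + V) W = alpha U W + alpha V W.
  by have := f11_linearl alpha W 1 U V; rewrite !scale1r.
have addr (U V W : g) : alpha U (V + W) = alpha U V + alpha U W.
  by have := f11_linearr alpha U 1 V W; rewrite !scale1r.
have := f11_alt alpha (X + Y).
by rewrite addl !addr !f11_alt addr0 add0r => /eqP; rewrite addr_eq0 => /eqP.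
Qed.

Lemma potential_skew X Y Z :
  la_inner (potential X Y) Z = - la_inner Y (potential X Z).
Proof. by rewrite (la_innerC _ Y) !potentialE f11_skew la_innerNl. Qed.

(** [<alpha(JY, Z), X> = - <alpha(Y, JZ), X>], by the type of [alpha] and
    [J^2 = -1]. *)
Lemma potential_J X Y : potential X (J_la H Y) = J_la H (potential X Y).
Proof.
apply: (@la_inner_nondeg _ _ _ H) => Z.
rewrite la_innerJl !potentialE -(f11_type alpha Y) J_laK.
pose F : {linear g -> g} :=
  HB.pack (alpha (J_la H Y))
    (GRing.isLinear.Build _ _ _ _ _ (f11_linearr alpha (J_la H Y))).
have -> : alpha (J_la H Y) (- Z) = - alpha (J_la H Y) Z by exact: (linearN F).
by rewrite la_innerNl opprK.
Qed.

Definition coef_smooth (X : vfield G) i := inner_smooth H X (coframe i).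

(** The first sum is the flat connection for which the frame is parallel; the
    second extends [potential] to all fields by bilinearity over smooth
    functions. *)
Definition nabla_of_form (X Y : vfield G) : vfield G :=
  \sum_i vf_scale (vf_act_smooth X (coef_smooth Y i)) (frame i) +
  \sum_i \sum_j vf_scale (coef_smooth X j)
    (vf_scale (coef_smooth Y i) (potential (frame j) (frame i))).

Lemma nabla_of_formE X Y p :
  nabla_of_form X Y p =
  \sum_i vf_act X (inner Y (coframe i)) p *: frame i p +
  \sum_i \sum_j inner X (coframe j) p *:
    (inner Y (coframe i) p *: potential (frame j) (frame i) p).
Proof.
rewrite -[LHS]/((\sum_i _ : vfield G) p + (\sum_i _ : vfield G) p) !vf_sumE.
by congr (_ + _); apply: eq_bigr => i _; rewrite vf_sumE.
Qed.

(** Left-invariant fields have constant coefficients in the frame, so the flat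
    part kills them. *)
Lemma nabla_of_form_la (X Y : g) : nabla_of_form X Y = potential X Y.
Proof.
apply/val_inj/funext => p; rewrite [LHS]nabla_of_formE.
rewrite big1 ?add0r => [|i _]; last first.
  have -> : inner Y (coframe i) = cst (la_inner Y (coframe i)).
    by apply/funext => q; exact: inner_la_cst.
  by rewrite vf_act_cst scale0r.
rewrite (linear_expansion H Y (@potential_linearr X)).
rewrite -[RHS]/((\sum_i _ : g) p) la_sumE.
apply: eq_bigr => i _.
rewrite (linear_expansion H X (@potential_linearl (frame i))).
rewrite scaler_sumr la_sumE.
apply: eq_bigr => j _.
by rewrite (inner_la_cst H X) (inner_la_cst H Y) scalerA mulrC -scalerA.
Qed.

Lemma nabla_of_form_addl X X' Y :
  nabla_of_form (X + X') Y = nabla_of_form X Y + nabla_of_form X' Y.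
Proof.
apply/val_inj/funext => p.
rewrite -[RHS]/(nabla_of_form X Y p + nabla_of_form X' Y p) [LHS]nabla_of_formE.
rewrite !nabla_of_formE addrACA; congr (_ + _); rewrite -big_split;
  apply: eq_bigr => i _ /=.
  by rewrite vf_actDl scalerDl.
by rewrite -big_split; apply: eq_bigr => j _; rewrite innerDl scalerDl.
Qed.

Lemma nabla_of_form_scalel f (sf : smooth_fun f) X Y :
  nabla_of_form (vf_scale sf X) Y = vf_scale sf (nabla_of_form X Y).
Proof.
apply/val_inj/funext => p.
rewrite -[RHS]/(f p *: nabla_of_form X Y p) [LHS]nabla_of_formE nabla_of_formE.
rewrite scalerDr !scaler_sumr; congr (_ + _); apply: eq_bigr => i _.
  by rewrite vf_actZl scalerA.
by rewrite scaler_sumr; apply: eq_bigr => j _; rewrite innerZl -scalerA.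
Qed.

Lemma nabla_of_form_addr X Y Y' :
  nabla_of_form X (Y + Y') = nabla_of_form X Y + nabla_of_form X Y'.
Proof.
apply/val_inj/funext => p.
rewrite -[RHS]/(nabla_of_form X Y p + nabla_of_form X Y' p) [LHS]nabla_of_formE.
rewrite !nabla_of_formE addrACA; congr (_ + _); rewrite -big_split;
  apply: eq_bigr => i _ /=.
  have -> : inner (Y + Y') (coframe i) =
      (fun q => inner Y (coframe i) q + inner Y' (coframe i) q).
    by apply/funext => q; rewrite innerDl.
  by rewrite vf_actD ?scalerDl//; exact: inner_smooth.
by rewrite -big_split; apply: eq_bigr => j _; rewrite innerDl scalerDl scalerDr.
Qed.

Lemma nabla_of_form_leibniz f (sf : smooth_fun f) X Y p :
  nabla_of_form X (vf_scale sf Y) p =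
  vf_act X f p *: Y p + f p *: nabla_of_form X Y p.
Proof.
rewrite !nabla_of_formE scalerDr !scaler_sumr addrA; congr (_ + _); last first.
  apply: eq_bigr => i _; rewrite scaler_sumr; apply: eq_bigr => j _.
  by rewrite innerZl !scalerA mulrCA mulrA.
rewrite {1}(frame_expansion H p (Y p)) scaler_sumr -big_split.
apply: eq_bigr => i _.
have -> : inner (vf_scale sf Y) (coframe i) =
    (fun q => f q * inner Y (coframe i) q).
  by apply/funext => q; rewrite innerZl.
rewrite vf_actM//; last exact: inner_smooth.
by rewrite addrC scalerDl !scalerA.
Qed.

Definition connection_of_form : connection G :=
  Connection nabla_of_form_addl nabla_of_form_scalel nabla_of_form_addr
    nabla_of_form_leibniz.

(** The defect is tensorial in [X], [Y] and [Z], and on left-invariant fields it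
    is the symmetric part of [potential X], which vanishes. *)
Lemma connection_of_form_metric X Y Z p :
  vf_act X (inner Y Z) p =
  inner (connection_of_form X Y) Z p + inner Y (connection_of_form X Z) p.
Proof.
set D := connection_of_form.
elim/(@vfield_ind _ _ _ H): X Y Z => [X X' IX IX' Y Z|f sf X IX Y Z|X].
- by rewrite vf_actDl IX IX' !nabla_addl innerDl innerDr addrACA.
- by rewrite vf_actZl IX !nabla_scalel innerZl innerZr mulrDr.
elim/(@vfield_ind _ _ _ H) => [Y Y' IY IY' Z|f sf Y IY Z|Y].
- have -> : inner (Y + Y') Z = (fun q => inner Y Z q + inner Y' Z q).
    by apply/funext => q; rewrite innerDl.
  rewrite vf_actD; do ?exact: inner_smooth.
  by rewrite IY IY' nabla_addr !innerDl addrACA.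
- have -> : inner (vf_scale sf Y) Z = (fun q => f q * inner Y Z q).
    by apply/funext => q; rewrite innerZl.
  rewrite vf_actM//; last exact: inner_smooth.
  rewrite IY innerZl.
  have -> : inner (D X (vf_scale sf Y)) Z p =
      vf_act X f p * inner Y Z p + f p * inner (D X Y) Z p.
    by rewrite /Defs.inner nabla_leibniz metricDl !metricZl.
  by rewrite mulrDr addrC addrA.
elim/(@vfield_ind _ _ _ H) => [Z Z' IZ IZ'|f sf Z IZ|Z].
- have -> : inner Y (Z + Z') = (fun q => inner Y Z q + inner Y Z' q).
    by apply/funext => q; rewrite innerDr.
  rewrite vf_actD; do ?exact: inner_smooth.
  by rewrite IZ IZ' nabla_addr !innerDr addrACA.
- have -> : inner Y (vf_scale sf Z) = (fun q => f q * inner Y Z q).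
    by apply/funext => q; rewrite innerZr.
  rewrite vf_actM//; last exact: inner_smooth.
  have -> : inner Y (D X (vf_scale sf Z)) p =
      vf_act X f p * inner Y Z p + f p * inner Y (D X Z) p.
    by rewrite /Defs.inner nabla_leibniz metricDr !metricZr.
  by rewrite IZ innerZr mulrDr -addrA [_ + vf_act _ _ _ * _]addrC.
have -> : inner Y Z = cst (la_inner Y Z).
  by apply/funext => q; exact: inner_la_cst.
rewrite vf_act_cst -[D X Y]/(nabla_of_form X Y) -[D X Z]/(nabla_of_form X Z).
rewrite !nabla_of_form_la !(inner_la_cst H).
rewrite -[LHS](subrr (la_inner Y (potential X Z))) [LHS]addrC.
by rewrite -potential_skew.
Qed.

(** Both sides obey the same Leibniz rule in [Y], as [J] is linear over the smooth
    functions; so the identity descends to [potential_J]. *)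
Lemma connection_of_form_J X Y :
  connection_of_form X (J_vf H Y) = J_vf H (connection_of_form X Y).
Proof.
set D := connection_of_form.
elim/(@vfield_ind _ _ _ H): X Y => [X X' IX IX' Y|f sf X IX Y|X].
- by rewrite !nabla_addl IX IX' J_vfD.
- by rewrite !nabla_scalel IX J_vfZ.
elim/(@vfield_ind _ _ _ H) => [Y Y' IY IY'|f sf Y IY|Y].
- by rewrite J_vfD !nabla_addr IY IY' J_vfD.
- apply/val_inj/funext => p.
  rewrite J_vfZ [LHS]nabla_leibniz IY.
  rewrite -[RHS]/(ah_J H p (D X (vf_scale sf Y) p)) nabla_leibniz.
  have Jlin := ah_J_linear H p.
  pose F : {linear 'rV[R]_n -> 'rV[R]_n} :=
    HB.pack (ah_J H p) (GRing.isLinear.Build _ _ _ _ _ Jlin).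
  by rewrite -[RHS]/(F _) linearD !linearZ.
rewrite -[J_vf H Y]/(J_la H Y : vfield G).
rewrite -[D X _]/(nabla_of_form X _) -[D X Y]/(nabla_of_form X Y).
by rewrite !nabla_of_form_la potential_J.
Qed.

Lemma connection_of_form_hermitian : hermitian_connection H connection_of_form.
Proof.
by split; [exact: connection_of_form_metric|exact: connection_of_form_J].
Qed.

Lemma connection_of_form_left_invariant :
  left_invariant_connection connection_of_form.
Proof.
move=> X Y; rewrite -[connection_of_form X Y]/(nabla_of_form X Y).
by rewrite nabla_of_form_la la_left_invariant.
Qed.

Definition lih_connection_of_form : lih_connection H :=
  LIHConnection connection_of_form_hermitian connection_of_form_left_invariant.

Lemma connection_of_formK : form_of_connection lih_connection_of_form = alpha.
Proof.
have E X Y : form_fun lih_connection_of_form X Y = alpha X Y.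
  apply: (@la_inner_nondeg _ _ _ H) => Z; rewrite form_funE.
  have -> : la_nabla lih_connection_of_form Z X = potential Z X.
    exact/val_inj/nabla_of_form_la.
  by rewrite potentialE.
rewrite /form_of_connection.
move: (form_linearl _) (form_linearr _) (form_alt _) (form_type _).
have -> : form_fun lih_connection_of_form = alpha.
  by apply/funext => X; apply/funext => Y.
case: alpha => a a1 a2 a3 a4 b1 b2 b3 b4 /=.
by congr Form11; exact: Prop_irrelevance.
Qed.

End FormToConnection.

Lemma form_of_connection_affine : affine_map form_of_connection.
Proof.
move=> t D0 D1 D DE X Y; apply: (@la_inner_nondeg _ _ _ H) => Z.
rewrite la_innerDl !la_innerZl /= !form_funE.
have -> : la_nabla D Z X = (1 - t) *: la_nabla D0 Z X + t *: la_nabla D1 Z X.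
  exact/val_inj/DE.
by rewrite la_innerDl !la_innerZl.
Qed.

End Correspondence.

Theorem corollary3p14 (R : realType) (n : nat) (G : lieGroupType R n)
  (H : left_invariant_almost_hermitian G) :
  exists Phi : lih_connection H -> form11 H, bijective Phi /\ affine_map Phi.
Proof.
exists (@form_of_connection R n G H); split; last exact: form_of_connection_affine.
exists (@lih_connection_of_form R n G H); last exact: connection_of_formK.
exact: inj_can_sym (@connection_of_formK R n G H)
  (@form_of_connection_inj R n G H).
Qed.
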